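(* Let $t\geq 2$ and $m\geq 1$ be integers, and set $\alpha=\alpha_{m,t}(1)=\frac{mt+t+1}{2(m+2)}$. Then the largest size of a $(t, mt+1)$-core partition with distinct parts is \[ \begin{cases} -\lfloor \alpha\rfloor^2\cdot \frac{m^2+2m}{2} + \lfloor \alpha\rfloor \cdot \frac{m^2t+mt+m}{2}, & \text{if } \{\alpha\}\leq 1/2, \\ -\lfloor \alpha+1\rfloor^2\cdot \frac{m^2+2m}{2} + \lfloor \alpha+1\rfloor \cdot \frac{m^2t+mt+m}{2}, & \text{if } \{\alpha\}> 1/2. \end{cases} \] Moreover, the number of $(t,mt+1)$-core partitions with distinct parts having this largest size is $2$ if $\{\alpha\}=1/2$, and $1$ if $\{\alpha\}\neq 1/2$.
   Context: A partition is a finite weakly decreasing sequence $\lambda=(\lambda_1,\ldots,\lambda_\ell)$ of positive integers; its size is $\sum_i\lambda_i$, and it has distinct parts if $\lambda_1>\lambda_2>\cdots>\lambda_\ell$. In the Young diagram of $\lambda$ (row $i$ has $\lambda_i$ left-justified boxes), the hook length of box $(i,j)$ is the number of boxes directly to its right, directly below it, plus the box itself. For a positive integer $s$, $\lambda$ is an $s$-core partition if no hook length is divisible by $s$; it is a $(t_1,t_2)$-core partition if it is both a $t_1$-core and a $t_2$-core. For $m,t\in\mathbb{N}$ and $x\in\mathbb{Z}$, $\alpha_{m,t}(x):=\frac{mt+t+x}{2(m+2)}$. $\lfloor x\rfloor$ is the largest integer not exceeding $x$ and $\{x\}=x-\lfloor x\rfloor$ is the fractional part. *)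

(* Defs.v *)
From HB Require Import structures.
From mathcomp Require Import all_boot all_order all_algebra.

Set Implicit Arguments.
Unset Strict Implicit.
Unset Printing Implicit Defensive.

Import Order.TTheory GRing.Theory Num.Theory.

(* Partitions are finite sequences of natural numbers; the empty partition is
   [::], of size [sumn [::] = 0]. *)

Definition is_partition (la : seq nat) : bool :=
  sorted geq la && all (fun k => 0 < k) la.

Definition distinct_parts (la : seq nat) : bool := sorted gtn la.

(* Rows and columns are numbered from 0: (i, j) is a box of la when
   i < size la and j < nth 0 la i. *)

Definition arm (la : seq nat) (i j : nat) : nat := nth 0 la i - j.+1.

Definition leg (la : seq nat) (i j : nat) : nat :=
  count (fun r => j < r) (drop i.+1 la).

Definition hook_length (la : seq nat) (i j : nat) : nat :=
  arm la i j + leg la i j + 1.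

Definition is_core (s : nat) (la : seq nat) : Prop :=
  forall i j : nat, i < size la -> j < nth 0 la i -> ~~ (s %| hook_length la i j).

Definition is_core2 (t1 t2 : nat) (la : seq nat) : Prop :=
  is_core t1 la /\ is_core t2 la.

Definition distinct_core (t1 t2 : nat) (la : seq nat) : Prop :=
  [/\ is_partition la, distinct_parts la & is_core2 t1 t2 la].

Definition largest_size (P : seq nat -> Prop) (N : nat) : Prop :=
  (exists2 la, P la & sumn la = N) /\ (forall la, P la -> sumn la <= N).

Definition has_exactly (P : seq nat -> Prop) (k : nat) : Prop :=
  exists s : seq (seq nat),
    [/\ uniq s, forall la, la \in s <-> P la & size s = k].

Local Open Scope ring_scope.

Definition alpha (m t : nat) (x : int) : rat :=
  (m%:R * t%:R + t%:R + x%:~R) / (2%:R * (m%:R + 2%:R)).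

Definition frac_part (x : rat) : rat := x - (Num.floor x)%:~R.

Definition size_formula (m t : nat) (k : int) : rat :=
  - (k%:~R ^+ 2) * ((m%:R ^+ 2 + 2%:R * m%:R) / 2%:R)
  + k%:~R * ((m%:R ^+ 2 * t%:R + m%:R * t%:R + m%:R) / 2%:R).

(* Main.v *)
(** Encode a partition by its beta-set, the set of first-column hook lengths:
    the hook lengths of the row with beta-number [y] are the [y - x] for [x < y]
    outside the beta-set.  On the [t]-abacus, [(t, mt+1)]-cores with distinct
    parts thus become height vectors [h] on the columns [0, ..., t-1] with
    [h 0 = 0], [h i <= m], and no two adjacent columns both nonempty.  Twice the
    size is a quadratic function of [h] which is strictly convex in each single
    height, so at a maximum every height is [0] or [m].  For [n] full columns the
    size is then largest exactly when these are [t-1, t-3, ..., t-2n+1], where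
    twice the size is [m n ((m+1)t + 1 - (m+2)n)]; this concave quadratic in [n]
    has its vertex at [alpha]. *)

Require Import Defs.
From HB Require Import structures.
From mathcomp Require Import all_boot all_order all_algebra.
From mathcomp Require Import zify ring lra.

Import Order.TTheory GRing.Theory Num.Theory.

Set Implicit Arguments.
Unset Strict Implicit.
Unset Printing Implicit Defensive.

(** * Beta-sets and the core condition *)

Fixpoint beta (la : seq nat) : seq nat :=
  if la is a :: la' then a + size la' :: beta la' else [::].

Fixpoint unbeta (s : seq nat) : seq nat :=
  if s is x :: s' then x - size s' :: unbeta s' else [::].

Lemma size_beta la : size (beta la) = size la.
Proof. by elim: la => //= a la ->. Qed.

Lemma size_unbeta s : size (unbeta s) = size s.
Proof. by elim: s => //= a s ->. Qed.

Lemma betaK la : unbeta (beta la) = la.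
Proof. by elim: la => //= a la IH; rewrite IH size_beta addnK. Qed.

Lemma sumn_beta la :
  2 * sumn (beta la) + size la = 2 * sumn la + size la * size la.
Proof. elim: la => //= a la; lia. Qed.

Lemma beta_lt a la :
  all (geq a) la -> forall x, x \in beta la -> x < a + size la.
Proof.
elim: la => //= b la IH /andP[/= hb hla] x; rewrite inE => /orP[/eqP->|/(IH hla)]; lia.
Qed.

Lemma beta_sorted la : sorted geq la -> sorted gtn (beta la).
Proof.
elim: la => //= a la IH hp; have hs := path_sorted hp.
rewrite path_sortedE; last by move=> x y z /= ? ?; lia.
rewrite IH // andbT; apply/allP => x.
apply: beta_lt; apply: order_path_min hp; move=> x' y z /= ? ?; lia.
Qed.

Lemma beta_pos la : all (fun k => 0 < k) la -> 0 \notin beta la.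
Proof.
by elim: la => //= a la IH /andP[ha hla]; rewrite inE negb_or IH // andbT; lia.
Qed.

(** Distinct parts drop by at least one per row and the shift drops by exactly one more, so
    successive beta-numbers are at least two apart. *)
Lemma beta_gap la x : sorted gtn la -> x \in beta la -> x.+1 \notin beta la.
Proof.
elim: la x => //= a la IH x hp.
have hs := path_sorted hp.
have hall : all (geq a.-1) la.
  have : all (gtn a) la by apply: order_path_min hp; move=> x' y z /= ? ?; lia.
  by apply: sub_all => y /=; lia.
have hlt := beta_lt hall.
rewrite !inE negb_or => /orP[/eqP->|hx].
  apply/andP; split; first lia.
  apply/negP => /hlt; lia.
rewrite IH // andbT; apply/eqP => e.
by case: la hp hs hall hlt hx e {IH} => //= b la hp hs hall hlt /hlt; move: hp => /andP[]; lia.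
Qed.

(** Number the steps of the boundary of the diagram from the bottom left: vertical steps are
    beta-numbers, horizontal ones are gaps. The step under column [j] comes after [j] horizontal
    steps and after one vertical step for each row of length at most [j]. *)
Lemma beta_gapsP la x : sorted geq la ->
  (x \notin beta la) <-> exists j, x = j + count (fun r => r <= j) la.
Proof.
elim: la x => [|b la IH] x hp /=; first by split=> // _; exists x; lia.
have hs := path_sorted hp.
have hall : all (geq b) la by apply: order_path_min hp; move=> x' y z /= ? ?; lia.
have hfull j : b <= j -> count (fun r => r <= j) la = size la.
  by move=> bj; apply/eqP; rewrite -all_count; apply: sub_all hall => y /=; lia.
have hcnt j : count (fun r => r <= j) la <= size la by exact: count_size.
rewrite inE negb_or; split.
  move=> /andP[xb /(IH _ hs)[j xE]].
  case: (ltnP j b) => jb; first by exists j; rewrite leqNgt jb.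
  move: xb; rewrite xE hfull // => xb; have jb' : b <= j.-1 by lia.
  (* The new row adds one to the count, so the column index drops by one. *)
  by exists j.-1; rewrite jb' hfull //; lia.
move=> [j ->]; case: (leqP b j) => bj.
  rewrite hfull //; apply/andP; split; first lia.
  by apply/negP => /(beta_lt hall); lia.
apply/andP; split; first by have := hcnt j; lia.
by apply/(IH _ hs); exists j; lia.
Qed.

Lemma is_core_cons s a la : is_core s (a :: la) <->
  (forall j, j < a -> ~~ (s %| hook_length (a :: la) 0 j)) /\ is_core s la.
Proof.
split=> [h|[h0 h] [|i] j].
- split=> [j ja|i j hi hj]; first exact: (h 0).
  exact: (h i.+1 j).
- by move=> _ /h0.
- by move=> hi hj; exact: (h i j).
Qed.

(** Induction on rows: removing the first row changes no other hook or beta-number, and the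
    first-row hook in column [j] is the top beta-number minus the gap of column [j]. *)
Lemma core_betaP s la : sorted geq la -> is_core s la <->
  forall y x, y \in beta la -> x < y -> x \notin beta la -> ~~ (s %| y - x).
Proof.
elim: la => [|a la IH] hp; first by split=> // _ i j.
have hs := path_sorted hp.
have hall : all (geq a) la by apply: order_path_min hp; move=> x' y z /= ? ?; lia.
have hlt := beta_lt hall.
have hcnt j : count (fun r => r <= j) la + count (fun r => j < r) la = size la.
  rewrite -(count_predC (fun r => r <= j)); congr (_ + _).
  by apply: eq_count => r /=; lia.
have hookE j : j < a ->
  hook_length (a :: la) 0 j = a + size la - (j + count (fun r => r <= j) la).
  rewrite /hook_length /arm /leg /= drop0; have := hcnt j; lia.
rewrite is_core_cons IH //=; split.
- move=> [h0 h] y x; rewrite !inE negb_or => /orP[/eqP->|hy] xy /andP[_ hx].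
    have /(beta_gapsP _ hs)[j xE] := hx.
    have ja : j < a.
      (* For [a <= j] no row is longer than [j], so the gap would be [j + size la], which is not
         below [y]. *)
      rewrite ltnNge; apply/negP => aj.
      have := hcnt j; have -> : count (fun r => j < r) la = 0; last lia.
      apply/eqP; rewrite -leqn0 leqNgt -has_count -all_predC.
      by apply: sub_all hall => r /=; lia.
    by rewrite xE -hookE //; exact: h0.
  exact: h.
- move=> h; split.
    move=> j ja; rewrite hookE //.
    have hc : count (fun r => r <= j) la <= size la by exact: count_size.
    apply: h; rewrite ?inE ?eqxx //; first lia.
    rewrite negb_or; apply/andP; split; first lia.
    by apply/(beta_gapsP _ hs); exists j.
  move=> y x hy xy hx; apply: h => //; first by rewrite inE hy orbT.
  by rewrite inE negb_or hx andbT; have := hlt _ hy; lia.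
Qed.

(* The last clause, on the head of [s] only, is what keeps the subtraction in
   [unbeta] from truncating. *)
Lemma unbeta_strict s :
  sorted gtn s -> 0 \notin s -> (forall x, x \in s -> x.+1 \notin s) ->
  [/\ beta (unbeta s) = s, sorted gtn (unbeta s),
      all (fun k => 0 < k) (unbeta s) & all (leq (size s)) (take 1 s)].
Proof.
elim: s => //= x s IH hp; rewrite inE negb_or => /andP[x0 s0] hgap.
have hs := path_sorted hp.
have [|e1 e2 e3 e4] := IH hs s0.
  by move=> y hy; have := hgap y; rewrite !inE hy orbT negb_or => /(_ isT)/andP[].
have hx : size s < x.
  case: s hp e4 {IH hs s0 hgap e1 e2 e3} => [|y s] /=; first by lia.
  by rewrite take0 /=; lia.
rewrite e1 take0 e3 !size_unbeta /= subnK; last lia.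
split=> //; last by rewrite hx.
  case: s hp e2 e4 hgap hx {IH hs s0 e1 e3} => [|y s] //= /andP[yx _] ->.
  rewrite take0 andbT => hy hgap _.
  have := hgap y; rewrite !inE eqxx orbT negb_or => /(_ isT)/andP[]; lia.
by rewrite subn_gt0 hx.
Qed.

(** * Cores with distinct parts as abacus heights *)

Definition abacus (t : nat) (h : nat -> nat) : seq nat :=
  rev (sort leq [seq i + k * t | i <- iota 0 t, k <- iota 0 (h i)]).

(** Since column 0 is empty, the adjacency of column [t - 1] with column 0 one row up needs no
    clause of its own. *)
Definition valid_heights (t m : nat) (h : nat -> nat) : Prop :=
  [/\ h 0 = 0, forall i, i < t -> h i <= m
    & forall i, i.+1 < t -> 0 < h i -> h i.+1 = 0].

Lemma eq_abacus t h h' : (forall i, i < t -> h i = h' i) -> abacus t h = abacus t h'.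
Proof.
move=> e; rewrite /abacus; congr (rev (sort _ (flatten _))).
by apply/eq_in_map => i; rewrite mem_iota add0n => /e ->.
Qed.

Lemma mem_abacus t h x : 0 < t -> (x \in abacus t h) = (x %/ t < h (x %% t)).
Proof.
move=> t0; rewrite mem_rev mem_sort; apply/allpairsPdep/idP.
  move=> [i [k [+ + ->]]]; rewrite !mem_iota !add0n /= => it kh.
  by rewrite addnC divnMDl // modnMDl modn_small // divn_small // addn0.
move=> hx; exists (x %% t), (x %/ t); rewrite !mem_iota !add0n /= hx ltn_pmod //.
by split=> //; rewrite addnC -divn_eq.
Qed.

Lemma abacus_sorted t h : 0 < t -> sorted gtn (abacus t h).
Proof.
move=> t0; rewrite /abacus rev_sorted ltn_sorted_uniq_leq sort_uniq.
rewrite sort_sorted ?andbT; last exact: leq_total.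
apply: allpairs_uniq_dep => [|i _|]; [exact: iota_uniq|exact: iota_uniq|].
move=> [i k] [i' k'] /allpairsPdep[a [b [+ + [-> ->]]]].
move=> + + /allpairsPdep[c [d [+ + [-> ->]]]]; rewrite !mem_iota !add0n /=.
move=> ha hb hc hd /eqP; rewrite [a + _]addnC [c + _]addnC => /eqP e.
have e1 : a = c by have /(congr1 (modn^~ t)) := e; rewrite !modnMDl !modn_small.
rewrite {}e1 in e *; congr Tagged; apply/eqP.
by rewrite -(eqn_pmul2r t0); apply/eqP; lia.
Qed.

Lemma size_abacus t h : size (abacus t h) = \sum_(i < t) h i.
Proof.
rewrite size_rev size_sort size_allpairs_dep sumnE big_map.
rewrite -(big_mkord xpredT) /index_iota subn0.
by apply: eq_bigr => i _; rewrite size_iota.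
Qed.

Lemma sumn_abacus t h :
  2 * sumn (abacus t h) + t * \sum_(i < t) h i =
  \sum_(i < t) (2 * i * h i + t * (h i * h i)).
Proof.
rewrite sumnE.
rewrite (perm_big [seq i + k * t | i <- iota 0 t, k <- iota 0 (h i)]); last first.
  by rewrite perm_rev perm_sort.
rewrite big_allpairs_dep /= -{1}[t in iota 0 t]subn0 -/(index_iota 0 t) big_mkord.
rewrite !big_distrr -big_split; apply: eq_bigr => i _ /=.
elim: (h i) => [|k IH]; first by rewrite big_nil; lia.
rewrite -(addn1 k) iotaD big_cat big_seq1 /= add0n; lia.
Qed.

Definition abacus_partition t h := unbeta (abacus t h).

Lemma abacus_core t m h : 0 < t -> valid_heights t m h ->
  distinct_core t (m * t + 1) (abacus_partition t h) /\
  beta (abacus_partition t h) = abacus t h.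
Proof.
move=> t0 [h0 hm hgap].
have hs := abacus_sorted h t0.
have B0 : 0 \notin abacus t h by rewrite mem_abacus // div0n mod0n h0.
have Bgap x : x \in abacus t h -> x.+1 \notin abacus t h.
  rewrite !mem_abacus // -leqNgt => hx.
  have xt := ltn_pmod x t0.
  have xE : x.+1 = x %/ t * t + (x %% t).+1 by rewrite addnS -divn_eq.
  case: (ltnP (x %% t).+1 t) => xt'.
    by rewrite {1}xE modnMDl modn_small // hgap //; apply: leq_ltn_trans hx.
  (* The successor wraps around to column 0, which is empty. *)
  have xt2 : (x %% t).+1 = t by lia.
  by rewrite {1}xE modnMDl xt2 modnn h0.
have [e1 e2 e3 _] := unbeta_strict hs B0 Bgap.
have geqs : sorted geq (unbeta (abacus t h)).
  by apply: sub_sorted e2 => x y /=; lia.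
split=> //; split=> //; first by rewrite /is_partition geqs.
split; apply/(core_betaP _ geqs); rewrite e1 => y x.
  rewrite !mem_abacus // -leqNgt => hy xy hx; apply/negP => dv.
  (* A multiple of [t] keeps the column, and a position below an occupied one is occupied. *)
  have em : x %% t = y %% t.
    by apply/eqP; rewrite eq_sym eqn_mod_dvd // ltnW.
  have := leq_div2r t (ltnW xy); rewrite em in hx; lia.
(* All beta-numbers are below [m * t], so no positive difference reaches [m * t + 1]. *)
rewrite mem_abacus // => hy xy _; apply/negP => /dvdn_leq.
have := hm _ (ltn_pmod y t0); have := ltn_pmod y t0; have := divn_eq y t; nia.
Qed.

Lemma core_abacus t m la : 0 < t -> distinct_core t (m * t + 1) la ->
  exists2 h, valid_heights t m h & beta la = abacus t h.
Proof.
move=> t0 [/andP[hge hpos] hd [c1 c2]].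
have B0 := beta_pos hpos; have Bgap x := @beta_gap la x hd.
have Bs := beta_sorted hge.
(* The beta-set of an [s]-core is closed under subtracting [s], since a gap there would give a hook
   of length [s]. *)
have down s : 0 < s -> is_core s la ->
    forall x, s <= x -> x \in beta la -> x - s \in beta la.
  move=> s0 /(core_betaP _ hge) h x sx hx; apply/negPn/negP => nx.
  by have := h _ _ hx _ nx; rewrite subKn // dvdnn => /(_ ltac:(lia)).
have downt i k k' : k' <= k -> i + k * t \in beta la -> i + k' * t \in beta la.
  elim: k => [|k IH] kk; first by have -> : k' = 0 by lia.
  case: (ltnP k k') => k1; first by have -> : k' = k.+1 by lia.
  move=> /(down t t0 c1) hd'; apply: IH => //.
  have -> : i + k * t = i + k.+1 * t - t by lia.
  by apply: hd'; lia.
have col0 k : k * t \notin beta la.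
  by apply/negP => /(downt 0 k 0 (leq0n k)); rewrite (negPf B0).
have colm i k : i < t -> m <= k -> i + k * t \notin beta la.
  move=> it mk; apply/negP => /(downt i k m mk) hx.
  case: i it hx => [|i] it hx; first by move: (col0 m); rewrite hx.
  (* Subtracting [m * t + 1] puts [i] in the beta-set, while sliding down column [i.+1] puts [i.+1]
     there: two consecutive beta-numbers. *)
  have := down _ _ c2 _ _ hx; rewrite addn1 ltnS leq0n.
  have -> : i.+1 + m * t - (m * t).+1 = i by lia.
  move=> /(_ isT ltac:(lia)) /Bgap.
  by have := downt i.+1 m 0 (leq0n m) hx; rewrite addn0 => ->.
(* [find] returns [m] when there is no gap, so [h i <= m] holds by construction. *)
pose h i := find (fun k => i + k * t \notin beta la) (iota 0 m).
have hP i k : i < t -> (i + k * t \in beta la) = (k < h i).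
  move=> it; case: (ltnP k (h i)) => hk.
    have := before_find 0 hk; rewrite nth_iota; last first.
      by apply: leq_trans hk _; rewrite -[leqRHS](size_iota 0 m) find_size.
    by rewrite add0n => /negbFE.
  case: (ltnP (h i) m) => him; last by apply/negbTE/colm => //; lia.
  have := him; rewrite -[ltnRHS](size_iota 0 m) -has_find => /(nth_find 0).
  rewrite -/(h i) nth_iota // add0n => nh; apply/negP => hx.
  by rewrite (downt _ _ _ hk hx) in nh.
have hP0 i : i < t -> (i \in beta la) = (0 < h i) by move=> it; rewrite -hP // addn0.
exists h.
  split.
  - by apply/eqP; rewrite -leqn0 leqNgt -hP0.
  - by move=> i it; rewrite -[leqRHS](size_iota 0 m) find_size.
  - move=> i it; rewrite -hP0 ?(ltnW it) // => /Bgap.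
    by rewrite hP0 // lt0n negbK => /eqP.
apply: (irr_sorted_eq (leT := gtn)) => //.
- by move=> x y z /= ? ?; lia.
- by move=> x /=; lia.
- exact: abacus_sorted.
move=> x; rewrite mem_abacus // -hP ?ltn_pmod //.
by rewrite addnC -divn_eq.
Qed.

(** * Twice the size as a quadratic in the heights *)

(** The result of eliminating the sum of the beta-numbers between [sumn_beta] and [sumn_abacus]. *)
Definition weight (t : nat) (h : nat -> nat) : int :=
  ((\sum_(i < t) (2 * i * h i + t * (h i * h i)))%N%:Z
   - (t%:Z - 1) * (\sum_(i < t) h i)%N%:Z - (\sum_(i < t) h i)%N%:Z ^+ 2)%R.

Lemma weight_sumn t h la :
  beta la = abacus t h -> ((2 * sumn la)%N%:Z)%R = weight t h.
Proof.
move=> e; have := sumn_beta la; have := sumn_abacus t h.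
rewrite -(size_beta la) e size_abacus /weight; lia.
Qed.

Lemma eq_weight t h h' : (forall i, i < t -> h i = h' i) -> weight t h = weight t h'.
Proof.
move=> e; rewrite /weight.
have -> : \sum_(i < t) h i = \sum_(i < t) h' i by apply: eq_bigr => i _; rewrite e.
congr (Posz _ - _ - _)%R; apply: eq_bigr => i _; by rewrite e.
Qed.

Definition set_height (h : nat -> nat) (p v : nat) : nat -> nat :=
  fun i => if i == p then v else h i.

(** [Q] and [L] collect the other columns; what remains is a quadratic in [v] with leading
    coefficient [t - 1]. *)
Lemma weight_set_height t h p : p < t -> exists Q L : int, forall v : nat,
  (weight t (set_height h p v) =
    2 * p%:Z * v%:Z + t%:Z * v%:Z ^+ 2 + Q - (t%:Z - 1) * (v%:Z + L) - (v%:Z + L) ^+ 2)%R.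
Proof.
move=> pt; pose o := Ordinal pt.
exists (\sum_(i < t | i != o) (2 * i * h i + t * (h i * h i)))%N%:Z%R.
exists (\sum_(i < t | i != o) h i)%N%:Z%R => v.
rewrite /weight (bigD1 o) //= (bigD1 (F := fun i : 'I_t => set_height h p v i) o) //=.
rewrite (eq_bigr (fun i : 'I_t => (2 * i * h i + t * (h i * h i))%N)); last first.
  by move=> i io; rewrite /set_height -[p]/(val o) (inj_eq val_inj) (negPf io).
rewrite (eq_bigr (F1 := fun i : 'I_t => set_height h p v i)
                 (fun i : 'I_t => h i)); last first.
  by move=> i io; rewrite /set_height -[p]/(val o) (inj_eq val_inj) (negPf io).
rewrite /set_height eqxx !PoszD !PoszM; ring.
Qed.

(* The weight is a strictly convex quadratic in each single height. *)
Lemma weight_convex t m h p : 2 <= t -> p < t -> 0 < h p < m ->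
  (weight t h < weight t (set_height h p 0) \/
   weight t h < weight t (set_height h p m))%R.
Proof.
move=> t2 pt /andP[v0 vm]; have [Q [L E]] := weight_set_height h pt.
have -> : weight t h = weight t (set_height h p (h p)).
  by apply: eq_weight => i _; rewrite /set_height; case: eqP => // ->.
rewrite !E; move: (h p) v0 vm => v v0 vm {E}.
set c := (X in (X < _ \/ _)%R); set c0 := (X in (_ < X \/ _)%R).
set cm := (X in (_ \/ _ < X)%R).
(* Convexity with [v] as a weighted mean of [0] and [m]: a positive combination of the two gains is
   positive, so one gain is. *)
have key : ((m%:Z - v%:Z) * (c0 - c) + v%:Z * (cm - c)
            = (t%:Z - 1) * v%:Z * m%:Z * (m%:Z - v%:Z))%R.
  rewrite /c /c0 /cm; ring.
have pos : (0 < (t%:Z - 1) * v%:Z * m%:Z * (m%:Z - v%:Z))%R.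
  by rewrite !mulr_gt0 //; lia.
rewrite -key in pos.
case: (ltP c c0) => [|l0]; first by left.
case: (ltP c cm) => [|lm]; first by right.
have p1 : (0 <= (m%:Z - v%:Z) * (c - c0))%R by rewrite mulr_ge0 //; lia.
have p2 : (0 <= v%:Z * (c - cm))%R by rewrite mulr_ge0 //; lia.
move: pos p1 p2; rewrite !mulrBr; lia.
Qed.

(** A nonempty column already has empty neighbours, so refilling it creates no conflict. *)
Lemma set_height_valid t m h p v : valid_heights t m h -> 0 < h p -> v <= m ->
  valid_heights t m (set_height h p v).
Proof.
move=> [h0 hm hgap] hp vm; rewrite /set_height; split.
- by case: eqP => // e; rewrite -e h0 in hp.
- by move=> i it; case: eqP => // _; exact: hm.
- move=> i it; case: (i =P p) => [ip|ne]; case: eqP => [e|ne'] //.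
  + lia.
  + by move=> _; apply: hgap => //; rewrite ip.
  + by move=> /(hgap _ it); rewrite e => e'; rewrite e' in hp.
  + exact: hgap.
Qed.

(** Move the intermediate heights one after another to their better end. The strict gain whenever
    something moves is what later identifies the maximisers. *)
Lemma extremal_heights t m h p : 2 <= t -> p <= t -> valid_heights t m h ->
  exists h', [/\ valid_heights t m h', forall i, i < p -> h' i = 0 \/ h' i = m
    & (forall i, h i = h' i) \/ (weight t h < weight t h')%R].
Proof.
move=> t2; elim: p => [|p IH] pt hv; first by exists h; split=> //; left.
have [h' [hv' hp cmp]] := IH (ltnW pt) hv.
case: (boolP (0 < h' p < m)) => hpm; last first.
  exists h'; split=> // i; rewrite ltnS leq_eqVlt => /orP[/eqP->|]; last exact: hp.
  by have [_ hm _] := hv'; have := hm p pt; lia.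
have [v [vE lt]] : exists v, (v = 0 \/ v = m) /\
    (weight t h' < weight t (set_height h' p v))%R.
  have [lt|lt] := weight_convex t2 pt hpm; first by exists 0; split=> //; left.
  by exists m; split=> //; right.
exists (set_height h' p v); split.
- by apply: set_height_valid => //; lia.
- move=> i; rewrite /set_height; case: eqP => // ne ip; apply: hp; lia.
- right; case: cmp => [e|lt']; last exact: lt_trans lt.
  by rewrite (@eq_weight t h h').
Qed.

(** * Choosing the full columns *)

Definition top_columns (t n i : nat) : bool := odd (t - i) && (t <= i + 2 * n).

Lemma top_columnsSS t n i : i <= t -> top_columns t.+2 n.+1 i = top_columns t n i.
Proof.
move=> it; rewrite /top_columns !subSn //= ?negbK; last lia.
by congr andb; lia.
Qed.

Lemma sum_top_columns t n : 2 * n <= t ->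
  \sum_(i < t) top_columns t n i = n /\ \sum_(i < t) i * top_columns t n i = n * (t - n).
Proof.
elim: n t => [|n IH] t nt.
  have z (i : 'I_t) : top_columns t 0 i = false.
    by rewrite /top_columns; have := ltn_ord i; lia.
  by split; apply: big1 => i _; rewrite z ?muln0.
case: t nt => [|[|t]] nt; [lia|lia|].
have [e1 e2] := IH t ltac:(lia).
rewrite !big_ord_recr /=.
have -> : top_columns t.+2 n.+1 t.+1 = true by rewrite /top_columns subSnn; lia.
have -> : top_columns t.+2 n.+1 t = false by rewrite top_columnsSS // /top_columns subnn.
rewrite (eq_bigr (fun i : 'I_t => nat_of_bool (top_columns t n i))); last first.
  by move=> i _; rewrite top_columnsSS // ltnW.
rewrite (eq_bigr (F1 := fun i : 'I_t => i * _)
                 (fun i : 'I_t => i * top_columns t n i)); last first.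
  by move=> i _; rewrite top_columnsSS // ltnW.
by rewrite e1 e2; nia.
Qed.

(** The [k]-th chosen column from the right is at most [t - 2k + 1]; summing bounds [S], with
    equality only if each is as far right as possible. The induction drops one column if the last is
    empty, and two if it is full. *)
Lemma sparse_columns_bound t (b : nat -> bool) :
  b 0 = false -> (forall i, i.+1 < t -> b i -> b i.+1 = false) ->
  let n := \sum_(i < t) b i in let S := \sum_(i < t) i * b i in
  [/\ 2 * n <= t, S + n * n <= n * t
    & S + n * n = n * t -> forall i, i < t -> b i = top_columns t n i].
Proof.
move=> b0; elim/ltn_ind: t => -[|[|t]] IH hb n S.
- by rewrite /n /S !big_ord0.
- rewrite /n /S !big_ord1 b0; split=> // _ [|i] // _.
have [i1 i2 i3] := IH t.+1 (ltnSn _) (fun i h => hb i (ltnW h)).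
case bt : (b t.+1); last first.
  have nE : n = \sum_(i < t.+1) b i by rewrite /n big_ord_recr /= bt addn0.
  have SE : S = \sum_(i < t.+1) i * b i by rewrite /S big_ord_recr /= bt muln0 addn0.
  rewrite -nE -SE in i1 i2 i3; split; [lia|nia|].
  (* The bound for one column fewer is smaller by [n], so equality leaves only [n = 0]. *)
  move=> e; have n0 : n = 0 by nia.
  move=> i it; rewrite n0 /top_columns; apply/idP/idP => [bi|]; last lia.
  by move: n0; rewrite /n (bigD1 (Ordinal it)) //= bi; lia.
have bt' : b t = false.
  by apply/negP => /hb; rewrite bt => /(_ (ltnSn _)).
have [j1 j2 j3] := IH t (ltnW (ltnSn _)) (fun i h => hb i (ltnW (ltnW h))).
have nE : n = (\sum_(i < t) b i).+1 by rewrite /n !big_ord_recr /= bt bt'; lia.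
have SE : S = \sum_(i < t) i * b i + t.+1.
  by rewrite /S !big_ord_recr /= bt bt'; lia.
move: j1 j2 j3 nE SE; set n' := \sum_(i < t) b i; set S' := \sum_(i < t) i * b i.
move=> j1 j2 j3 -> ->; split; [lia|nia|].
move=> e i; rewrite ltnS leq_eqVlt => /orP[/eqP->|].
  by rewrite bt /top_columns subSnn; lia.
rewrite ltnS => it; rewrite top_columnsSS //.
move: it; rewrite leq_eqVlt => /orP[/eqP->|it].
  by rewrite bt' /top_columns subnn.
by apply: j3 => //; nia.
Qed.

Definition top_heights (t m n : nat) : nat -> nat := fun i => m * top_columns t n i.

Definition twice_top_size (t m : nat) (n : int) : int :=
  (m%:Z * (n * ((m%:Z + 1) * t%:Z + 1 - (m%:Z + 2) * n)))%R.

(** Heights [0] and [m] satisfy [h * h = m * h], so only [n] and [S] matter; the subtracted term is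
    the defect in [sparse_columns_bound]. *)
Lemma weight_columns t m (b : nat -> bool) :
  let n := (\sum_(i < t) b i)%N in
  let S := (\sum_(i < t) i * b i)%N in
  (weight t (fun i => m * b i)%N =
   twice_top_size t m n%:Z - 2 * m%:Z * ((n * t)%N%:Z - (n * n)%N%:Z - S%:Z))%R.
Proof.
move=> n S; rewrite /weight.
have -> : \sum_(i < t) m * b i = m * n by rewrite /n big_distrr.
have -> : \sum_(i < t) (2 * i * (m * b i) + t * (m * b i * (m * b i)))
   = 2 * m * S + t * (m * m) * n.
  rewrite /n /S !big_distrr -big_split; apply: eq_bigr => i _ /=.
  by case: (b i); lia.
rewrite /twice_top_size; lia.
Qed.

Definition top_partition (t m n : nat) : seq nat :=
  abacus_partition t (top_heights t m n).

(** The length [m * n] later tells two optimal partitions apart. *)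
Lemma top_partitionP t m n : 0 < t -> 2 * n <= t ->
  [/\ distinct_core t (m * t + 1) (top_partition t m n),
      size (top_partition t m n) = m * n
    & ((2 * sumn (top_partition t m n))%N%:Z = twice_top_size t m n%:Z)%R].
Proof.
move=> t0 nt; have [e1 e2] := sum_top_columns nt.
have hv : valid_heights t m (top_heights t m n).
  rewrite /top_heights; split.
  - suff -> : top_columns t n 0 = false by rewrite muln0.
    (* Reaching column 0 would force [t = 2 * n], which is even. *)
    by apply/negP; rewrite /top_columns; lia.
  - by move=> i it; case: top_columns; lia.
  - move=> i it; rewrite /top_columns; lia.
have [hc hb] := abacus_core t0 hv; split=> //.
  rewrite -size_beta hb size_abacus /top_heights -big_distrr /= e1; lia.
rewrite (weight_sumn hb) /top_heights weight_columns e1 e2; lia.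
Qed.

(** Two losses separate [la] from the bound: rounding the heights and the column defect. Equality
    makes both vanish, which determines the heights. *)
Lemma core_size_bound t m la : 2 <= t -> 1 <= m ->
  distinct_core t (m * t + 1) la ->
  exists n : nat, ((2 * sumn la)%N%:Z <= twice_top_size t m n%:Z)%R /\
    ((2 * sumn la)%N%:Z = twice_top_size t m n%:Z -> la = top_partition t m n)%R.
Proof.
move=> t2 m1 hc; have t0 : 0 < t by lia.
have [h hv hb] := core_abacus t0 hc.
have [h' [[h0 hm hgap] ext cmp]] := extremal_heights t2 (leqnn t) hv.
pose b i := h' i == m.
have h'E i : i < t -> h' i = m * b i.
  by rewrite /b => /ext[]->; rewrite ?eqxx ?muln1 // ltn_eqF // muln0.
have b0 : b 0 = false by rewrite /b h0; lia.
have bgap i : i.+1 < t -> b i -> b i.+1 = false.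
  by move=> it /eqP bi; rewrite /b hgap //; lia.
have [b1 b2 b3] := sparse_columns_bound b0 bgap.
exists (\sum_(i < t) b i); rewrite (weight_sumn hb).
have wle : (weight t h <= weight t h')%R.
  by case: cmp => [e|/ltW //]; rewrite (@eq_weight t h h').
have wE : weight t h' = weight t (fun i => m * b i) by exact: eq_weight.
rewrite weight_columns in wE.
move: b1 b2 b3 wE; set n := \sum_(i < t) b i; set S := \sum_(i < t) i * b i.
move=> b1 b2 b3 wE.
have defect0 : (0 <= 2 * m%:Z * ((n * t)%N%:Z - (n * n)%N%:Z - S%:Z))%R.
  by rewrite mulr_ge0 //; lia.
split; first by lia.
move=> e; have SE : S + n * n = n * t.
  have /eqP : (2 * m%:Z * ((n * t)%N%:Z - (n * n)%N%:Z - S%:Z) = 0)%R by lia.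
  by rewrite mulf_eq0 => /orP[/eqP|/eqP]; lia.
have hh i : h i = h' i by case: cmp => [//|]; lia.
rewrite -[la]betaK hb /top_partition /abacus_partition; congr unbeta.
by apply: eq_abacus => i it; rewrite hh h'E // b3.
Qed.

(** * Optimising the number of full columns *)

(** Here [x] is [2 * (m + 2)] times the distance from [k] to the vertex [alpha], so the window says
    that [k] is the integer nearest to [alpha], ties rounded down; at a tie [k + 1] is equally
    good. *)
Lemma twice_top_size_max t m (k n : int) : (1 <= m)%N ->
  let x := ((m%:Z + 1) * t%:Z + 1 - 2 * (m%:Z + 2) * k)%R in
  (- (m%:Z + 2) < x <= m%:Z + 2)%R ->
  (twice_top_size t m n <= twice_top_size t m k)%R /\
  (twice_top_size t m n = twice_top_size t m k ->
     n = k \/ n = k + 1 /\ x = m%:Z + 2)%R.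
Proof.
move=> m1 x /andP[x1 x2].
have diffE : (twice_top_size t m n =
    twice_top_size t m k - m%:Z * ((n - k) * ((m%:Z + 2) * (n - k) - x)))%R.
  rewrite /twice_top_size /x; ring.
rewrite {}diffE.
have [d0|d1|->] := ltgtP n k; last by rewrite subrr; split; [lia|left].
- have : (0 < m%:Z * ((n - k) * ((m%:Z + 2) * (n - k) - x)))%R.
    by rewrite mulr_gt0 ?nmulr_rgt0 //; nia.
  lia.
- have [d2|d2] : (n = k + 1 \/ k + 2 <= n)%R by lia.
    rewrite d2 [(k + 1 - k)%R]addrC addKr mul1r mulr1.
    have : (0 <= m%:Z * (m%:Z + 2 - x))%R by rewrite mulr_ge0 //; lia.
    move=> pos; split; first lia.
    move=> e; right; split=> //.
    have /eqP : (m%:Z * (m%:Z + 2 - x) = 0)%R by lia.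
    by rewrite mulf_eq0 => /orP[/eqP|/eqP]; lia.
  have : (0 < m%:Z * ((n - k) * ((m%:Z + 2) * (n - k) - x)))%R.
    by rewrite !mulr_gt0 //; nia.
  lia.
Qed.

Lemma largest_distinct_cores t m k : 2 <= t -> 1 <= m ->
  let x := ((m%:Z + 1) * t%:Z + 1 - 2 * (m%:Z + 2) * k%:Z)%R in
  (- (m%:Z + 2) < x <= m%:Z + 2)%R ->
  let N := sumn (top_partition t m k) in
  [/\ largest_size (distinct_core t (m * t + 1)) N,
     (2 * N)%N%:Z%R = twice_top_size t m k%:Z
   & has_exactly (fun la => distinct_core t (m * t + 1) la /\ sumn la = N)
       (if x == m%:Z + 2 then 2 else 1)%R].
Proof.
move=> t2 m1 x hx N; have t0 : 0 < t by lia.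
have max n := twice_top_size_max n m1 hx.
have xb := hx; move: xb => /andP[x1 x2].
(* The lower end of the window makes [k] nonadjacent columns fit. *)
have kt : 2 * k <= t by move: x1; rewrite /x; nia.
have [c1 s1 w1] := top_partitionP m t0 kt.
have bound la : distinct_core t (m * t + 1) la -> sumn la <= N.
  move=> /(core_size_bound t2 m1)[n [le _]]; have [le' _] := max n%:Z%R.
  rewrite -/N in w1; lia.
have uniqueness la : distinct_core t (m * t + 1) la -> sumn la = N ->
    la = top_partition t m k \/ x = (m%:Z + 2)%R /\ la = top_partition t m k.+1.
  move=> /(core_size_bound t2 m1)[n [le eqn]] sN.
  have [le' eq'] := max n%:Z%R; rewrite -/N in w1; rewrite sN w1 in le eqn.
  have e : twice_top_size t m n%:Z = twice_top_size t m k%:Z by lia.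
  case: (eq' e) => [nk|[nk xM]].
    by left; rewrite eqn ?e //; congr top_partition; lia.
  by right; split=> //; rewrite eqn ?e //; congr top_partition; lia.
split=> //; first by split=> //; exists (top_partition t m k).
case: eqP => [xM|xM]; last first.
  exists [:: top_partition t m k]; split=> // la; rewrite inE; split.
    by move=> /eqP->.
  by move=> [/uniqueness h /h[->|[]]].
have kt' : 2 * k.+1 <= t by move: xM; rewrite /x; nia.
have [c1' s1' w1'] := top_partitionP m t0 kt'.
have e : twice_top_size t m k.+1%:Z = twice_top_size t m k%:Z.
  rewrite /twice_top_size; have := xM; rewrite /x => xM'.
  (* At the tie both values become [m * (m + 2) * k * (k + 1)]. *)
  have -> : ((m%:Z + 1) * t%:Z + 1 = (m%:Z + 2) * (2 * k%:Z + 1))%R by lia.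
  rewrite -addn1 PoszD; ring.
exists [:: top_partition t m k; top_partition t m k.+1]; split=> //.
  rewrite /= inE andbT; apply/eqP => /(congr1 size); rewrite s1 s1'; lia.
move=> la; rewrite !inE; split.
  by move=> /orP[]/eqP-> //; split=> //; rewrite -/N in w1; lia.
by move=> [/uniqueness h /h[->|[_ ->]]]; rewrite eqxx ?orbT.
Qed.

(** * Translation to floors and fractional parts *)

Local Open Scope ring_scope.

Lemma size_formulaE m t k : 2 * size_formula m t k = (twice_top_size t m k)%:~R.
Proof.
rewrite /size_formula /twice_top_size !(intrD, intrM, rmorphN) /=.
by rewrite -!pmulrn; field.
Qed.

(** The fractional part is [y / (2 * (m + 2))]; clearing the denominator gives integer
    comparisons. *)
Lemma frac_alpha_cmp t m : let f := Num.floor (alpha m t 1) in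
  let y := (m%:Z + 1) * t%:Z + 1 - 2 * (m%:Z + 2) * f in
  [/\ 0 <= y < 2 * (m%:Z + 2),
      (frac_part (alpha m t 1) <= 1 / 2%:R) = (y <= m%:Z + 2)
    & (frac_part (alpha m t 1) == 1 / 2%:R) = (y == m%:Z + 2)].
Proof.
move=> f y.
have M0 : 0 < (m%:R + 2%:R : rat) by rewrite ltr_wpDl.
have fracE : frac_part (alpha m t 1) = y%:~R / (2 * (m%:R + 2)).
  rewrite /frac_part -/f /alpha /y !(intrD, intrM, rmorphN) /= -!pmulrn; field.
  by rewrite gt_eqF.
have /andP[f1 f2] := floor_itv (alpha m t 1).
have D0 : 0 < 2 * (m%:R + 2%:R : rat) by rewrite mulr_gt0.
have ME : m%:R + 2 = (m%:Z + 2)%:~R :> rat by rewrite intrD.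
have fr0 : 0 <= frac_part (alpha m t 1) < 1.
  by rewrite /frac_part; move: f1 f2; rewrite -/f intrD /=; lra.
have -> : 1 / 2%:R = (m%:Z + 2)%:~R / (2 * (m%:R + 2)) :> rat.
  by rewrite -ME; field; rewrite gt_eqF.
rewrite fracE in fr0 *; split.
- move: fr0 => /andP[]; rewrite pmulr_lge0 ?invr_gt0 // ler0z => -> /=.
  by rewrite ltr_pdivrMr // mul1r ME -(intrM _ 2) ltr_int.
- by rewrite ler_pM2r ?invr_gt0 // ler_int.
- by rewrite !eq_le !ler_pM2r ?invr_gt0 // !ler_int.
Qed.

Theorem theorem1p1 (t m : nat) (ht : (2 <= t)%N) (hm : (1 <= m)%N) :
  let a := alpha m t 1 in
  exists N : nat,
    [/\ largest_size (distinct_core t (m * t + 1)) N,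
        N%:R = (if frac_part a <= 1 / 2%:R
                then size_formula m t (Num.floor a)
                else size_formula m t (Num.floor (a + 1)))
      & has_exactly
          (fun la => distinct_core t (m * t + 1) la /\ sumn la = N)
          (if frac_part a == 1 / 2%:R then 2%N else 1%N)].
Proof.
move=> a; have [/andP[y0 y1] -> ->] := frac_alpha_cmp t m.
have -> : Num.floor (a + 1) = Num.floor a + 1 by rewrite floorDrz ?floor1.
rewrite -/a in y0 y1 *; set f := Num.floor a in y0 y1 *.
have f0 : 0 <= f.
  by rewrite /f floor_ge0 /a /alpha divr_ge0 // ?addr_ge0 ?mulr_ge0 // addr_ge0.
have sizeE (N : nat) k : (2 * N)%N%:Z = twice_top_size t m k -> N%:R = size_formula m t k.
  move=> e; apply: (mulfI (x := 2%:R)) => //.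
  by rewrite size_formulaE -e -natrM.
case: leP => hy.
  have [k kE] : exists k : nat, f = k by exists (absz f); lia.
  rewrite kE in y0 y1 hy *.
  have [|h1 h2 h3] := @largest_distinct_cores t m k ht hm; first lia.
  by exists (sumn (top_partition t m k)); split=> //; exact: sizeE.
(* Rounding up lowers [y] by [2 * (m + 2)], into the negative half of the window, where no tie
   occurs. *)
have [k kE] : exists k : nat, f + 1 = k by exists (absz (f + 1)); lia.
have fE : f = k%:Z - 1 by lia.
rewrite kE {}fE in y0 y1 hy *.
have [|h1 h2 h3] := @largest_distinct_cores t m k ht hm; first lia.
exists (sumn (top_partition t m k)); split=> //; first exact: sizeE.
by move: h3; case: eqP; [lia|rewrite gt_eqF].
Qed.
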